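(* Let $q$ be a prime power and $n$ a positive integer. Then $\chi'_2(n,q)\ge (q-1)n+1$. Moreover, if $q=p$ is a prime, then $\chi'_2(n,q)\le q^{\lceil\log_q n\rceil+1}$.
   Context: Let $V_n=\mathbb{F}_q^n$ be the set of all length-$n$ vectors over the finite field $\mathbb{F}_q$. The Hamming distance $d_H(\mathbf{x},\mathbf{y})$ between $\mathbf{x},\mathbf{y}\in V_n$ is the number of coordinates in which they differ. A coloring $\Gamma:V_n\to\{1,\dots,L\}$ is called a $d$-distance coloring if $\Gamma(\mathbf{x})\neq\Gamma(\mathbf{y})$ for all distinct $\mathbf{x},\mathbf{y}\in V_n$ with $d_H(\mathbf{x},\mathbf{y})\le d$. $\chi'_d(n,q)$ denotes the minimum number $L$ of colors for which a $d$-distance coloring of $V_n$ exists. *)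

(* Defs.v *)
From mathcomp Require Import all_boot all_algebra.

Set Implicit Arguments.
Unset Strict Implicit.
Unset Printing Implicit Defensive.

Definition prime_power (q : nat) : Prop :=
  exists p k : nat, [/\ prime p, 0 < k & q = p ^ k].

Section DistanceColoring.

Variables (F : finFieldType) (n : nat).

Local Notation V := 'rV[F]_n.

Definition hamming_dist (x y : V) : nat :=
  #|[set i : 'I_n | x ord0 i != y ord0 i]|.

Definition distance_coloring (d : nat) (C : eqType) (Gamma : V -> C) : bool :=
  [forall x : V, forall y : V,
    (x != y) && (hamming_dist x y <= d) ==> (Gamma x != Gamma y)].

(* The colors 1, ..., L are represented by the elements 0, ..., L-1 of 'I_L. *)
Definition distance_colorable (d L : nat) : bool :=
  [exists Gamma : {ffun V -> 'I_L}, distance_coloring d Gamma].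

Lemma distance_colorable_ex (d : nat) : exists L, distance_colorable d L.
Proof.
exists #|{: V}|; apply/existsP; exists [ffun x => enum_rank x].
apply/forallP => x; apply/forallP => y; apply/implyP => /andP[xy _].
by rewrite !ffunE (inj_eq enum_rank_inj).
Qed.

Definition chi' (d : nat) : nat := ex_minn (distance_colorable_ex d).

End DistanceColoring.

(* Main.v *)
Require Import Defs.
From mathcomp Require Import all_boot all_algebra.

(** The Hamming ball of radius 1 around 0 has [(q - 1) n + 1] points, any two at
    distance at most 2, so its points need distinct colors.  Conversely, color
    [x] by its syndrome for the parity-check matrix with columns [(1, v_k)], the
    [v_k] being distinct vectors of [F^m] with [m] the least exponent such that
    [n <= q^m]: two such columns are linearly independent, so no nonzero vector
    of weight at most 2 has syndrome zero. *)

Set Implicit Arguments.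
Unset Strict Implicit.
Unset Printing Implicit Defensive.

Import GRing.Theory.
Local Open Scope ring_scope.

Section Coloring.

Variables (F : finFieldType) (n : nat).

Local Notation V := 'rV[F]_n.

Lemma hamming_dist_sym (x y : V) : hamming_dist x y = hamming_dist y x.
Proof. by apply: eq_card => i; rewrite !inE eq_sym. Qed.

Lemma hamming_dist_triangle (x y z : V) :
  (hamming_dist x z <= hamming_dist x y + hamming_dist y z)%N.
Proof.
apply: leq_trans (leq_card_setU _ _); apply/subset_leq_card/subsetP => i.
rewrite !inE; apply: contraR; rewrite negb_or !negbK => /andP[/eqP-> /eqP->].
exact: eqxx.
Qed.

Lemma hamming_dist_scale_delta (a : F) (i : 'I_n) :
  (hamming_dist (a *: delta_mx ord0 i) 0 <= 1)%N.
Proof.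
rewrite -[leqRHS](cards1 i); apply/subset_leq_card/subsetP => k.
rewrite !inE !mxE eqxx /=; apply: contraR => /negPf->.
by rewrite mulr0.
Qed.

Lemma distance_coloring_inj d (C : eqType) (Gamma : V -> C) x y :
  distance_coloring d Gamma -> (hamming_dist x y <= d)%N ->
  Gamma x = Gamma y -> x = y.
Proof.
move=> /forallP/(_ x)/forallP/(_ y)/implyP col dxy /eqP Gxy.
by apply/eqP; apply: contraTT Gxy => nxy; apply: col; rewrite nxy.
Qed.

(** Renumbering by [enum_rank] lets colors come from any finite type, so that syndromes can serve as
    colors directly. *)
Lemma chi'_le d (C : finType) (Gamma : V -> C) :
  distance_coloring d Gamma -> (chi' F n d <= #|C|)%N.
Proof.
move=> col; rewrite /chi'; case: ex_minnP => L _; apply.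
apply/existsP; exists [ffun x => enum_rank (Gamma x)].
apply/forallP => x; apply/forallP => y; apply/implyP => xy.
rewrite !ffunE (inj_eq enum_rank_inj).
by move/forallP/(_ x)/forallP/(_ y)/implyP: col; apply.
Qed.

(** The index type makes the count immediate: [None] is the center, and [Some (i, a)] is the word
    whose only nonzero entry is [a], at [i]. *)
Definition ball1 (u : option ('I_n * {a : F | a != 0})) : V :=
  if u is Some (i, a) then val a *: delta_mx ord0 i else 0.

Lemma ball1_inj : injective ball1.
Proof.
have neq0 (i : 'I_n) (a : {a : F | a != 0}) :
    val a *: delta_mx ord0 i != 0 :> V.
  apply/eqP => /rowP/(_ i); rewrite !mxE !eqxx mulr1 => /eqP.
  exact/negP/(valP a).
move=> [[i a]|] [[j b]|] //= E; last 2 first.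
- by case/eqP: (neq0 i a).
- by case/eqP: (neq0 j b).
(* At coordinate [i] the second word is [b] if [i = j] and [0] otherwise; the latter contradicts
   [a != 0]. *)
move/rowP/(_ i): E; rewrite !mxE !eqxx /= mulr1.
case: eqVneq => [-> | _]; first by rewrite mulr1 => /val_inj->.
by rewrite mulr0 => /eqP a0; case/negP: (valP a).
Qed.

Lemma hamming_dist_ball1 u : (hamming_dist (ball1 u) 0 <= 1)%N.
Proof.
case: u => [[i a]|] /=; first exact: hamming_dist_scale_delta.
by rewrite /hamming_dist (eq_card0 (_ : _ =i pred0)) // => i; rewrite inE eqxx.
Qed.

Lemma chi'2_ge : ((#|F| - 1) * n + 1 <= chi' F n 2)%N.
Proof.
rewrite /chi'; case: ex_minnP => L /existsP[Gamma col] _.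
have -> : ((#|F| - 1) * n + 1 = #|{: option ('I_n * {a : F | a != 0%R})}|)%N.
  rewrite card_option card_prod card_ord card_sig addn1 mulnC.
  have -> : #|[pred a : F | a != 0]| = #|predC1 (0 : F)| by apply: eq_card.
  by rewrite cardC1 subn1.
rewrite -[L in (_ <= L)%N]card_ord.
apply: (@leq_card _ _ (fun u => Gamma (ball1 u))) => u w Guw.
apply: ball1_inj; apply: distance_coloring_inj col _ Guw.
apply: leq_trans (hamming_dist_triangle _ 0 _) _.
by rewrite (hamming_dist_sym 0) (leq_add (n1 := 1) (n2 := 1))
  ?hamming_dist_ball1.
Qed.

Definition syndrome m (v : 'I_n -> 'rV[F]_m) (x : V) : F * 'rV[F]_m :=
  (\sum_k x ord0 k, \sum_k x ord0 k *: v k).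

Lemma syndrome_coloring m (v : 'I_n -> 'rV[F]_m) :
  injective v -> distance_coloring 2 (syndrome v).
Proof.
move=> v_inj; apply/forallP => x; apply/forallP => y; apply/implyP.
case/andP=> xy dxy; apply/eqP => -[/eqP sxy /eqP vxy].
pose z := x - y.
have zE k : z ord0 k = x ord0 k - y ord0 k by rewrite !mxE.
have sz : \sum_k z ord0 k = 0.
  by apply/eqP; move: sxy; rewrite -subr_eq0 -sumrB; under eq_bigr do rewrite -zE.
have vz : \sum_k z ord0 k *: v k = 0.
  apply/eqP; move: vxy; rewrite -subr_eq0 -sumrB.
  by under eq_bigr do rewrite -scalerBl -zE.
have [i zi] : exists i, z ord0 i != 0.
  by apply/rV0Pn; rewrite subr_eq0.
(* The entries of [z] sum to zero, so a single nonzero entry is impossible. *)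
have [j ji zj] : exists2 j, j != i & z ord0 j != 0.
  apply/exists_inP; apply: contraR zi => /exists_inPn z0.
  by rewrite -sz (bigD1 i) //= big1 ?addr0 // => k /z0; rewrite negbK => /eqP.
(* A third nonzero entry would make [x] and [y] differ in three places. *)
have supp k : k != i -> k != j -> z ord0 k = 0.
  move=> ki kj; apply/eqP; apply: contraLR dxy => zk; rewrite -ltnNge.
  have <- : #|k |: [set i; j]| = 3%N.
    by rewrite cardsU1 !inE negb_or ki kj cards2 eq_sym ji.
  apply/subset_leq_card/subsetP => l; rewrite !inE -subr_eq0 -zE.
  by case/or3P => /eqP->.
(* Subtracting [v j] times the zero sum of [z] isolates the term at [i]. *)
have : \sum_k z ord0 k *: (v k - v j) = 0.
  under eq_bigr do rewrite scalerBr.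
  by rewrite sumrB vz -scaler_suml sz scale0r subr0.
(* The term at [j] dies because [v j - v j = 0], the others by [supp]. *)
rewrite (bigD1 i) //= big1 ?addr0 => [|k ki]; last first.
  by have [->|kj] := eqVneq k j; rewrite ?subrr ?scaler0 // supp // scale0r.
move/eqP; rewrite scaler_eq0 (negPf zi) subr_eq0 /= => /eqP/v_inj ij.
by rewrite ij eqxx in ji.
Qed.

Lemma chi'2_le m : (n <= #|F| ^ m)%N -> (chi' F n 2 <= #|F| ^ (m + 1))%N.
Proof.
move=> le_n; have le_n' : (n <= #|{: 'rV[F]_m}|)%N by rewrite card_mx mul1n.
(* The [v k] are the first [n] vectors in the enumeration of the [#|F| ^ m] available ones. *)
pose v (k : 'I_n) : 'rV[F]_m := enum_val (widen_ord le_n' k).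
have v_inj : injective v.
  by move=> k l /enum_val_inj/(congr1 val)/= kl; apply: val_inj.
have := chi'_le (syndrome_coloring v_inj).
by rewrite card_prod card_mx mul1n addn1 expnS.
Qed.

End Coloring.

Local Close Scope ring_scope.

Theorem theorem2p3 (q n : nat) (F : finFieldType) :
  prime_power q -> 0 < n -> #|F| = q ->
  (q - 1) * n + 1 <= chi' F n 2 /\
  (prime q -> chi' F n 2 <= q ^ (up_log q n + 1)).
Proof.
move=> _ _ <-; split=> [|pr_q]; first exact: chi'2_ge.
(* For a base above 1, [up_log] is the rounded-up logarithm, so [m = up_log q n] satisfies
   [n <= q ^ m]. *)
by apply: chi'2_le; apply: up_logP; apply: prime_gt1.
Qed.
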